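(* Let $r\geq 3$, $s\geq 1$ and $n>3r^2s$ be integers. Let $\mathcal{H}_1,\dots,\mathcal{H}_s$ be properly edge-colored $r$-uniform hypergraphs on a common vertex set of $n$ vertices such that $\sigma_r(\mathcal{H}_i)>r\left(\binom{n-1}{r-1}-\binom{n-s}{r-1}\right)$ for every $i$. Then there exists an $s$-rainbow matching in $\mathcal{H}_1,\dots,\mathcal{H}_s$.
   Context: An $r$-uniform hypergraph on an $n$-element vertex set $V$ is a family of $r$-subsets of $V$ (its edges). The degree $\deg(v)$ is the number of edges containing $v$; for an $r$-set $S$, $\deg(S)=\sum_{v\in S}\deg(v)$. The Ore-degree $\sigma_r(\mathcal{H})$ is the minimum of $\deg(S)$ over all $r$-subsets $S\subseteq V$ that are not edges of $\mathcal{H}$. A hypergraph whose edges are assigned colors is properly edge-colored if no two edges sharing a vertex receive the same color. An $s$-rainbow matching in properly edge-colored hypergraphs $\mathcal{H}_1,\dots,\mathcal{H}_s$ is a collection of pairwise disjoint edges $e_1,\dots,e_s$ with $e_i\in\mathcal{H}_i$ for each $i$, all having distinct colors. *)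

(* Defs.v *)
From HB Require Import structures.
From mathcomp Require Import all_boot all_order all_algebra.
From mathcomp Require Export constructive_ereal.

Set Implicit Arguments.
Unset Strict Implicit.
Unset Printing Implicit Defensive.

Import Order.TTheory GRing.Theory Num.Theory.

Section Hypergraphs.
Variable V : finType.
Implicit Types (r : nat) (H : {set {set V}}) (S e f : {set V}) (v : V).

Definition uniform r H : Prop := forall e, e \in H -> #|e| = r.

Definition deg H v : nat := #|[set e in H | v \in e]|.

Definition deg_set H S : nat := \sum_(v in S) deg H v.

(* Valued in the extended integers so that the minimum over no non-edges
   (the complete r-uniform hypergraph) is +oo. *)
Definition ore_degree r H : \bar int :=
  \big[Order.min/+oo%E]_(S : {set V} | (#|S| == r) && (S \notin H))
    (((deg_set H S)%:Z)%:E)%E.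

(* Only the values of col on the edges of H matter. *)
Definition proper_coloring (C : eqType) H (col : {set V} -> C) : Prop :=
  forall e f, e \in H -> f \in H -> e != f ->
    ~~ [disjoint e & f] -> col e != col f.

Definition rainbow_matching (C : eqType) s (H : 'I_s -> {set {set V}})
    (col : 'I_s -> {set V} -> C) (e : 'I_s -> {set V}) : Prop :=
  [/\ forall i, e i \in H i,
      forall i j, i != j -> [disjoint e i & e j]
    & forall i j, i != j -> col i (e i) != col j (e j)].

Lemma lt_ore_degree r H (k : nat) :
  (((k%:Z)%:E < ore_degree r H)%E : Prop) <->
  (forall S, #|S| = r -> S \notin H -> k < deg_set H S).
Proof.
rewrite /ore_degree; split=> [+ S cS nS | h].
- rewrite (bigD1 S) /=; last by rewrite cS eqxx.
  by rewrite lt_min => /andP[+ _]; rewrite lte_fin ltz_nat.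
- elim/big_ind: _ => [|x y hx hy|S /andP[/eqP cS nS]].
  + exact: ltry.
  + by rewrite lt_min hx hy.
  + by rewrite lte_fin ltz_nat h.
Qed.

End Hypergraphs.

(* Main.v *)
(* Induction on s.  Put t = s - 1 and B = C(n-2, r-2).
   - If some vertex v has degree > rtB + t in some H_i, delete v from the other
     hypergraphs (Pascal's rule makes the Ore condition survive with n-1, s-1),
     find a rainbow matching there and extend it by an edge of H_i through v.
   - Otherwise, if some H_i has at most t vertices of degree > 2tB + t, the edges
     of H_i meeting or sharing a colour with a rainbow matching of the others
     number at most t((3r-2)tB + rt + n/r).  Averaging the degree sum over all
     r-sets shows that the Ore condition forces more edges than that.
   - Otherwise there are distinct v_i of degree > 2tB + t in H_i.  Their links,
     away from the other v_j, are (r-1)-uniform, have more than t(B+1) edges and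
     are injectively coloured, and the same trichotomy, by induction on the
     uniformity, gives a rainbow matching of links. *)
Require Import Defs.
From mathcomp Require Import all_boot all_order all_algebra.
From mathcomp Require Import zify.

Set Implicit Arguments.
Unset Strict Implicit.
Unset Printing Implicit Defensive.

(** * Differences of binomial coefficients and numerical bounds *)

Lemma leq_bin_self n k : 0 < k < n -> n <= 'C(n, k).
Proof.
elim: n k => [|n IHn] [|k] //= kn; rewrite binS.
have [<-|kn'] := eqVneq k.+1 n; first by rewrite binn binSn.
have ge1 : 0 < 'C(n, k) by rewrite bin_gt0; lia.
have := IHn k.+1; lia.
Qed.

(** Pascal's rule telescopes the difference into the [t] terms C(m + j, k) with j < t. The largest
    of them bounds each from above; the smallest bounds each from below in [bin_sub_lb]. *)
Lemma bin_sub_ub m t k :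
  'C(m + t, k.+1) <= 'C(m, k.+1) + t * 'C((m + t).-1, k).
Proof.
elim: t => [|t IHt]; first by rewrite addn0 mul0n addn0.
rewrite addnS binS mulSn /=.
have : 'C((m + t).-1, k) <= 'C(m + t, k) by rewrite leq_bin2l // leq_pred.
by nia.
Qed.

Lemma bin_sub_lb m t k : 'C(m, k.+1) + t * 'C(m, k) <= 'C(m + t, k.+1).
Proof.
elim: t => [|t IHt]; first by rewrite addn0 mul0n addn0.
rewrite addnS binS mulSn.
have : 'C(m, k) <= 'C(m + t, k) by rewrite leq_bin2l // leq_addr.
by lia.
Qed.

Lemma mul_bin_diag_sub n k : 0 < k -> n * 'C(n - 1, k - 1) = k * 'C(n, k).
Proof. by case: k => // k _; rewrite !subn1 mul_bin_diag. Qed.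

(** Supplies the edge bound of [rainbow_step] for injective colourings, where [q] is 1. Since (n -
    1)B = kN, the size of [n] makes N outweigh the terms in tB. *)
Lemma dense_arith k n t : 0 < k -> 3 * k.+1 ^ 2 * t.+1 <= n ->
  (3 * k + 1) * t * 'C(n - 2, k - 1) + k.+1 * t + 1 <= 'C(n - 1, k) + 1.
Proof.
move=> k0 nk; rewrite leq_add2r.
set B := 'C(n - 2, k - 1); set N := 'C(n - 1, k).
have diag : (n - 1) * B = k * N.
  by rewrite -mul_bin_diag_sub // /B; congr (_ * 'C(_, _)); lia.
(* Turns the term (k + 1)t into 2tB, so that the coefficients of tB add up to 3k + 3. *)
have Bk : k.+1 <= 2 * B.
  have [kE|k1] := eqVneq k 1; first by rewrite /B kE subnn bin0.
  have : n - 2 <= B by apply: leq_bin_self; nia.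
  by nia.
rewrite -(leq_pmul2l k0) -diag.
apply: (@leq_trans (3 * k * k.+1 * t * B)); last by rewrite leq_mul2r; nia.
apply: (@leq_trans (k * ((3 * k + 1) * t * B + 2 * B * t))); last by nia.
by rewrite leq_mul2l leq_add2l leq_mul2r Bk !orbT.
Qed.

(** With r = k + 1, the counting hypothesis makes [e] at least about nD / r, where D is about tB. As
    n > 3r^2(t + 1), this beats the target by a margin that scales with B, and B >= n - 2 absorbs
    the remaining errors of order r^2. *)
Lemma ore_arith k n t e q :
    1 < k -> 0 < t -> 3 * k.+1 ^ 2 * t.+1 < n -> q * k.+1 <= n ->
    n * 'C(n - 1, k) * ('C(n - 1, k) - 'C(n - t.+1, k))
      <= k.+1 * e * ('C(n - 1, k) + ('C(n - 1, k) - 'C(n - t.+1, k))) ->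
  t * ((3 * k + 1) * t * 'C(n - 2, k - 1) + k.+1 * t + q) < e.
Proof.
move=> k1 t0 nk qn.
set N := 'C(n - 1, k); set D := N - _; set B := 'C(n - 2, k - 1).
pose c := 'C(n - t.+1, k - 1).
have N0 : 0 < N by rewrite bin_gt0; nia.
have [r Er] : exists r, r = k.+1 by exists k.+1.
rewrite -Er in nk qn *.
have rr : r <= r ^ 2 by nia.
have kr : k - 1 <= r by lia.
have nr : 6 * r ^ 2 <= n - 1 by nia.
have rr3 : 3 * r <= r ^ 2 by nia.
have nt : 3 * r ^ 2 * t <= n - 2 by nia.
have n3 : 3 * r ^ 2 * t <= n by lia.
have diag : (n - 1) * B = k * N.
  by rewrite -mul_bin_diag_sub ?(ltnW k1) // /B; congr (_ * 'C(_, _)); lia.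
have n1E : n - 1 = (n - t.+1) + t by nia.
have kE : k = (k - 1).+1 by lia.
have Dub : D <= t * B.
  have := bin_sub_ub (n - t.+1) t (k - 1).
  have -> : ((n - t.+1) + t).-1 = n - 2 by nia.
  by rewrite -n1E -kE -/N -/B /D; lia.
have Dlb : t * c <= D.
  by have := bin_sub_lb (n - t.+1) t (k - 1); rewrite -n1E -kE -/N -/c /D; lia.
(* Passing from B to [c], whose upper index is t - 1 lower, loses at most the fraction (k - 1) /
   (3r^2) of B. *)
have cB : 3 * r ^ 2 * B <= 3 * r ^ 2 * c + (k - 1) * B.
  have := bin_sub_ub (n - t.+1) (t - 1) (k - 2).
  have -> : (n - t.+1) + (t - 1) = n - 2 by nia.
  have -> : (k - 2).+1 = k - 1 by lia.
  rewrite -/B -/c; set b := 'C(_, k - 2).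
  have bE : (n - 2) * b = (k - 1) * B.
    rewrite -(@mul_bin_diag_sub (n - 2)) ?subn_gt0 // /b.
    by congr (_ * 'C(_, _)); lia.
  move=> leB.
  have h2 : 3 * r ^ 2 * t * b <= (k - 1) * B by rewrite -bE leq_mul2r nt orbT.
  have h3 : B <= c + t * b.
    by apply: leq_trans leB _; rewrite leq_add2l leq_mul2r leq_subr orbT.
  have := leq_mul (leqnn (3 * r ^ 2)) h3; lia.
have Bn : n - 2 <= B by apply: leq_bin_self; nia.
(* Makes N + D at most (1 + 1/(3r))N, whence the factor 3r + 1 below. *)
have DN : 3 * r * D <= N.
  have h1 : 3 * r ^ 2 * t * D <= t * (k * N).
    rewrite -diag; apply: (@leq_trans ((n - 1) * D)).
      by rewrite leq_mul2r; lia.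
    by rewrite mulnCA leq_mul2l Dub orbT.
  have h2 : 3 * r ^ 2 * D <= k * N by rewrite -(leq_pmul2l t0); lia.
  have h3 : r * (3 * r * D) <= r * N.
    apply: leq_trans (_ : k * N <= _); last by rewrite leq_mul2r; lia.
    by apply: leq_trans h2; lia.
  by move: h3; rewrite leq_pmul2l // Er.
move=> Hcount.
have nD : 3 * n * D <= (3 * r + 1) * e.
  rewrite -(leq_pmul2l N0).
  have := leq_mul (leqnn e) DN.
  by lia.
rewrite ltnNge; apply/negP => leE.
set Y := (3 * k + 1) * t * B + r * t + q in leE.
have h1 : n * (3 * r ^ 2) * B <= (3 * r + 1) * r ^ 2 * Y + n * (k - 1) * B.
  rewrite -(leq_pmul2l t0).
  have a1 : n * (3 * r ^ 2 * (t * B)) <= n * (3 * r ^ 2 * D + t * ((k - 1) * B)).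
    rewrite leq_mul2l; apply/orP; right.
    have := leq_mul (leqnn t) cB; have := leq_mul (leqnn (3 * r ^ 2)) Dlb; lia.
  have a2 : r ^ 2 * (3 * n * D) <= r ^ 2 * ((3 * r + 1) * (t * Y)).
    rewrite leq_mul2l (leq_trans nD) ?orbT //.
    by rewrite leq_mul2l leE orbT.
  by lia.
have h2 : r ^ 2 * Y <= r ^ 2 * ((3 * k + 1) * B + r) * t + r * n.
  have := leq_mul (leqnn r) qn; rewrite /Y; nia.
have h3 : n * (3 * r ^ 2) * B
    <= (3 * r + 1) * (r ^ 2 * ((3 * k + 1) * B + r) * t + r * n) + n * (k - 1) * B.
  by apply: leq_trans h1 _; rewrite leq_add2r -mulnA leq_mul2l h2 orbT.
(* What is left of 3r^2 B after the loss in [c] and the share r(3r + 1) caused by q <= n / r. *)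
pose P := (3 * r ^ 2 - (k - 1)) * B - r * (3 * r + 1).
have PE : P + (k - 1) * B + r * (3 * r + 1) = 3 * r ^ 2 * B.
  have rB : r * (3 * r + 1) <= (3 * r ^ 2 - (k - 1)) * B by apply: leq_mul; lia.
  by rewrite /P addnAC subnK // -mulnDl subnK //; lia.
have h4 : n * P <= (3 * r + 1) * (r ^ 2 * ((3 * k + 1) * B + r) * t).
  have nB : n * (3 * r ^ 2 * B) = n * P + n * ((k - 1) * B) + n * (r * (3 * r + 1)).
    by rewrite -PE !mulnDr.
  by clear -h3 nB; clearbody P B; lia.
have h5 : r ^ 2 * t * (3 * P) <= r ^ 2 * t * ((3 * r + 1) * ((3 * k + 1) * B + r)).
  apply: leq_trans (_ : n * P <= _); last by apply: leq_trans h4 _; lia.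
  by rewrite mulnA leq_mul2r mulnC mulnA n3 orbT.
have h6 : 3 * P <= (3 * r + 1) * ((3 * k + 1) * B + r).
  by move: h5; rewrite leq_pmul2l // muln_gt0 expn_gt0 t0 Er.
(* The coefficient 8 is 9r^2 - 3(k - 1) - (3r + 1)(3k + 1) at k = r - 1. The bound contradicts B >=
   n - 2 >= 6r^2 - 1. *)
have h7 : 8 * B <= 4 * (r * (3 * r + 1)).
  suff : 3 * (3 * r ^ 2 * B)
      = 3 * ((k - 1) * B) + (3 * r + 1) * ((3 * k + 1) * B) + 8 * B.
    by rewrite -PE; lia.
  by rewrite Er kE; move: (k - 1) => j; rewrite subn1 /=; lia.
by lia.
Qed.

(** * Degrees, codegrees and colour classes *)

Section RainbowMatchings.
Variables (V J : finType) (C : eqType).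
Implicit Types (A : {set J}) (U W X S f g : {set V}) (E : {set {set V}}).
Implicit Types (F G : J -> {set {set V}}) (col : J -> {set V} -> C).
Implicit Types (e : J -> {set V}).

(** Ground sets [U] and index sets [A] are subsets of fixed types, so the inductions can drop
    vertices and hypergraphs without changing types. *)
Definition uniform_on U k E := forall f, f \in E -> f \subset U /\ #|f| = k.

Definition rainbow_on A F col e : Prop :=
  [/\ {in A, forall i, e i \in F i},
      {in A &, forall i j, i != j -> [disjoint e i & e j]}
    & {in A &, forall i j, i != j -> col i (e i) != col j (e j)}].

Lemma degE E v : deg E v = \sum_(f in E) (v \in f).
Proof.
by rewrite /deg -sum1_card big_mkcond [RHS]big_mkcond /=; apply: eq_bigr => f _;
  rewrite inE; case: (f \in E); case: (v \in f).
Qed.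

Lemma uniform_onS U k E E' : E' \subset E -> uniform_on U k E -> uniform_on U k E'.
Proof. by move=> /subsetP s h f /s /h. Qed.

Lemma proper_coloringS E E' (c : {set V} -> C) :
  E' \subset E -> proper_coloring E c -> proper_coloring E' c.
Proof. by move=> /subsetP s h f g /s ? /s ?; apply: h. Qed.

Lemma inj_proper E (c : {set V} -> C) :
  {in E &, injective c} -> proper_coloring E c.
Proof. by move=> h f g fE gE + _; apply: contra_neq; apply: h. Qed.

(** Removing [X] injects the edges into the subsets of U minus X of size k - |X|. *)
Lemma card_edges_through U X k E :
    uniform_on U k E -> X \subset U -> {in E, forall f, X \subset f} ->
  #|E| <= 'C(#|U| - #|X|, k - #|X|).
Proof.
move=> unif XU XE; rewrite -(setIidPr XU) -cardsD (setIidPr XU) -cards_draws.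
have inj : {in E &, injective (fun f => f :\: X)}.
  move=> f g fE gE /= eq_fg; rewrite -(setID f X) -(setID g X) eq_fg.
  by rewrite (setIidPr (XE f fE)) (setIidPr (XE g gE)).
rewrite -(card_in_imset inj).
apply/subset_leq_card/subsetP => _ /imsetP[f fE ->].
have [fU fk] := unif f fE; rewrite !inE setSD //=.
by rewrite cardsD (setIidPr (XE f fE)) fk.
Qed.

Lemma deg_le U k E v : uniform_on U k E -> deg E v <= 'C(#|U| - 1, k - 1).
Proof.
move=> unif; rewrite /deg; set E' := [set f in E | _].
have sE : E' \subset E by apply/subsetP => f; rewrite !inE => /andP[].
have [->|[f0 f0E]] := set_0Vmem E'; first by rewrite cards0.
have vE f : f \in E' -> [set v] \subset f by rewrite inE sub1set => /andP[].
have vU : [set v] \subset U.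
  by apply: subset_trans (vE _ f0E) _; case: (unif f0); first exact: (subsetP sE).
by have := card_edges_through (uniform_onS sE unif) vU vE; rewrite cards1.
Qed.

Lemma codeg_le U k E (u v : V) : uniform_on U k E -> u != v ->
  deg [set f in E | v \in f] u <= 'C(#|U| - 2, k - 2).
Proof.
move=> unif uv; rewrite /deg.
set E' := [set f in _ | _].
have sE : E' \subset E by apply/subsetP => f; rewrite !inE => /andP[/andP[]].
have [->|[f0 f0E]] := set_0Vmem E'; first by rewrite cards0.
have XE f : f \in E' -> [set u; v] \subset f.
  by rewrite !inE subUset !sub1set => /andP[/andP[_ ->] ->].
have XU : [set u; v] \subset U.
  by apply: subset_trans (XE _ f0E) _; case: (unif f0); first exact: (subsetP sE).
by have := card_edges_through (uniform_onS sE unif) XU XE; rewrite cards2 uv.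
Qed.

(** A colour class of a proper colouring consists of pairwise disjoint [k]-sets inside [U]. *)
Lemma card_color_class_proper U k E (c : {set V} -> C) x :
    uniform_on U k E -> proper_coloring E c -> 0 < k ->
  #|[set f in E | c f == x]| <= #|U| %/ k.
Proof.
move=> unif prop k0; rewrite leq_divRL //.
set E' := [set f in E | _].
have sE : E' \subset E by apply/subsetP => f; rewrite !inE => /andP[].
have tI : trivIset E'.
  apply/trivIsetP => f g; rewrite !inE => /andP[fE /eqP cf] /andP[gE /eqP cg] fg.
  by apply: contraT => /(prop _ _ fE gE fg); rewrite cf cg eqxx.
have /eqP <- : #|cover E'| == #|E'| * k.
  rewrite -(eqP tI) -sum_nat_const; apply/eqP/eq_bigr => f /(subsetP sE) fE.
  by case: (unif f fE).
apply/subset_leq_card/bigcupsP => f /(subsetP sE) fE.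
by case: (unif f fE).
Qed.

Lemma card_color_class_inj E (c : {set V} -> C) x :
  {in E &, injective c} -> #|[set f in E | c f == x]| <= 1.
Proof.
move=> inj; apply/card_le1P => f; rewrite !inE => /andP[fE /eqP cf] g.
rewrite !inE; apply/andP/eqP => [[gE /eqP cg]|->]; last by rewrite fE cf eqxx.
by apply: inj => //; rewrite cf cg.
Qed.

Lemma proper_inj_star E (c : {set V} -> C) v :
  proper_coloring E c -> {in [set f in E | v \in f] &, injective c}.
Proof.
move=> prop f g; rewrite !inE => /andP[fE vf] /andP[gE vg] cfg.
apply/eqP; apply: contraT => fg.
suff nd : ~~ [disjoint f & g] by have := prop _ _ fE gE fg nd; rewrite cfg eqxx.
by rewrite -setI_eq0; apply/set0Pn; exists v; rewrite inE vf.
Qed.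

(** * Greedy extension of a rainbow matching *)

(** Each edge that meets [W] or has its colour in [K] is counted at least once on the left, so some
    edge is neither. *)
Lemma greedy_edge E W (c : {set V} -> C) (K : seq C) q :
    (forall x, #|[set f in E | c f == x]| <= q) ->
    \sum_(w in W) deg E w + size K * q < #|E| ->
  exists2 f, f \in E & [disjoint f & W] && (c f \notin K).
Proof.
move=> cq big; apply/exists_inP; apply: contraLR big.
rewrite negb_exists_in => /forall_inP bad; rewrite -leqNgt.
have colle : \sum_(x <- K) \sum_(f in E) (c f == x) <= size K * q.
  rewrite -sum1_size big_distrl /=; apply: leq_sum => x _; rewrite mul1n.
  apply: leq_trans (cq x); rewrite -sum1_card big_mkcond [leqRHS]big_mkcond /=.
  by apply: leq_sum => f _; rewrite inE; case: (f \in E); case: (c f == x).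
apply: leq_trans (leq_add (leqnn _) colle).
rewrite (eq_bigr _ (fun w _ => degE E w)) exchange_big [X in _ + X]exchange_big /=.
rewrite -big_split /= -sum1_card; apply: leq_sum => f /bad.
rewrite negb_and negbK => /orP[|cK].
  rewrite -setI_eq0 => /set0Pn[w]; rewrite inE => /andP[wf wW].
  by rewrite (bigD1 w) //= wf.
by rewrite (big_rem (c f)) //= eqxx addnA addnAC addn1.
Qed.

Lemma rainbow_onS A F G col e : {in A, forall i, F i \subset G i} ->
  rainbow_on A F col e -> rainbow_on A G col e.
Proof. by move=> s [h1 h2 h3]; split=> // i iA; apply/(subsetP (s i iA))/h1. Qed.

Lemma card_rainbow_union U k A F col e :
    {in A, forall i, uniform_on U k (F i)} -> rainbow_on A F col e ->
  #|\bigcup_(i in A) e i| <= k * #|A|.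
Proof.
move=> unif [eF _ _]; rewrite mulnC -sum_nat_const.
apply: (big_ind2 (fun S m => #|S| <= m)); first by rewrite cards0.
  move=> S m S' m' le le'; apply: leq_trans (leq_card_setU _ _).1 _.
  exact: leq_add.
by move=> i iA; case: (unif i iA _ (eF i iA)) => _ ->.
Qed.

(** The new edge is sought in a subfamily [E] so that the search can be confined to a star, where
    degrees are codegrees and colours are distinct. *)
Lemma rainbow_extend A F col e i E q :
    i \in A -> E \subset F i -> rainbow_on (A :\ i) F col e ->
    (forall x, #|[set f in E | col i f == x]| <= q) ->
    \sum_(w in \bigcup_(j in A :\ i) e j) deg E w + #|A|.-1 * q < #|E| ->
  exists e', rainbow_on A F col e'.
Proof.
move=> iA EF [eF edisj ecol] cq big.
have cA : size [seq col j (e j) | j <- enum (A :\ i)] = #|A|.-1.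
  by rewrite size_map -cardE (cardsD1 i A) iA.
rewrite -cA in big.
have [f fE /andP[fW fK]] := greedy_edge cq big.
have fdisj j : j \in A -> j != i -> [disjoint f & e j].
  move=> jA ji; apply: disjointWr fW.
  by rewrite (bigcup_sup j) // !inE ji.
have fcol j : j \in A -> j != i -> col i f != col j (e j).
  move=> jA ji; apply: contraNneq fK => ->.
  by apply/map_f; rewrite mem_enum !inE ji.
exists (fun j => if j == i then f else e j); split.
- move=> j jA; case: eqVneq => [->|ji]; first exact: (subsetP EF).
  by apply: eF; rewrite !inE ji.
- move=> j l jA lA; case: (eqVneq j i) => [->|ji]; case: (eqVneq l i) => [_|li] //.
  + by move=> _; apply: fdisj.
  + by move=> _; rewrite disjoint_sym; apply: fdisj.
  + by apply: edisj; rewrite !inE ?ji ?li.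
- move=> j l jA lA; case: (eqVneq j i) => [->|ji]; case: (eqVneq l i) => [->|li] //.
  + by move=> _; apply: fcol.
  + by move=> _; rewrite eq_sym; apply: fcol.
  + by apply: ecol; rewrite !inE ?ji ?li.
Qed.

Definition del_vertex F (v : V) : J -> {set {set V}} :=
  fun i => [set f in F i | v \notin f].

Lemma del_vertexS F v i : del_vertex F v i \subset F i.
Proof. by apply/subsetP => f; rewrite inE => /andP[]. Qed.

Lemma card_del_vertex F v i : #|F i| = deg (F i) v + #|del_vertex F v i|.
Proof.
rewrite -(cardsID [set f : {set V} | v \in f]); congr (_ + _); apply: eq_card => f.
  by rewrite !inE.
by rewrite !inE andbC.
Qed.

(** The matching avoids [v], so each of its vertices blocks at most a codegree of edges through [v];
    each used colour blocks at most one, because edges through [v] have distinct colours. *)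
Lemma rainbow_extend_high U k A F col e i v :
    i \in A -> {in A, forall j, uniform_on U k (F j)} ->
    proper_coloring (F i) (col i) ->
    rainbow_on (A :\ i) (del_vertex F v) col e ->
    k * #|A|.-1 * 'C(#|U| - 2, k - 2) + #|A|.-1 < deg (F i) v ->
  exists e', rainbow_on A F col e'.
Proof.
move=> iA unif prop he big.
have sAi : {subset A :\ i <= A} by move=> j; rewrite inE => /andP[].
have he' : rainbow_on (A :\ i) F col e.
  by apply: rainbow_onS he => j _; apply: del_vertexS.
pose E := [set f in F i | v \in f].
have EF : E \subset F i by apply/subsetP => f; rewrite inE => /andP[].
apply: (rainbow_extend (E := E) (q := 1) iA EF he').
  by move=> x; apply/card_color_class_inj/proper_inj_star.
apply: leq_ltn_trans big; rewrite muln1 leq_add2r.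
apply: (@leq_trans (\sum_(w in \bigcup_(j in A :\ i) e j) 'C(#|U| - 2, k - 2))).
  apply: leq_sum => w /bigcupP[j jA wj].
  apply: codeg_le; first exact: unif.
  apply: contraTneq wj => ->.
  by case: he => /(_ j jA); rewrite inE => /andP[].
rewrite sum_nat_const leq_mul2r; apply/orP; right.
have := card_rainbow_union (fun j jA => unif j (sAi j jA)) he'.
by rewrite (cardsD1 i A) iA.
Qed.

Lemma rainbow_extend_few U k A F col e i q d T :
    i \in A -> {in A, forall j, uniform_on U k (F j)} ->
    rainbow_on (A :\ i) F col e ->
    (forall x, #|[set f in F i | col i f == x]| <= q) ->
    {in U, forall v, deg (F i) v <= T + d} ->
    #|[set v in U | T < deg (F i) v]| <= #|A|.-1 ->
    #|A|.-1 * (k * T + d + q) < #|F i| ->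
  exists e', rainbow_on A F col e'.
Proof.
move=> iA unif he cq degle few big.
have sAi : {subset A :\ i <= A} by move=> j; rewrite inE => /andP[].
apply: (rainbow_extend iA (subxx _) he cq); apply: leq_ltn_trans big.
rewrite mulnDr leq_add2r; set W := \bigcup_(j in _) _.
have WU w : w \in W -> w \in U.
  case/bigcupP => j jA wj; case: he => /(_ j jA) ej _ _.
  by apply: (subsetP (proj1 (unif j (sAi j jA) _ ej))).
have cW : #|W| <= k * #|A|.-1.
  have := card_rainbow_union (fun j jA => unif j (sAi j jA)) he.
  by rewrite (cardsD1 i A) iA.
(* Every vertex is charged T, and the extra [d] only when its degree exceeds T, which happens at
   most |A| - 1 times. *)
apply: (@leq_trans (\sum_(w in W) (T + (T < deg (F i) w) * d))).
  apply: leq_sum => w /WU wU; have := degle w wU.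
  by case: ltnP => [_|le _]; rewrite ?mul1n ?mul0n ?addn0.
rewrite big_split /= sum_nat_const -big_distrl /= mulnDr leq_add //.
  by rewrite mulnCA mulnA leq_mul2r cW orbT.
rewrite leq_mul2r; apply/orP; right; apply: leq_trans few.
rewrite -sum1_card big_mkcond [leqRHS]big_mkcond /=.
apply: leq_sum => w _; rewrite inE; case wW: (w \in W) => //.
by rewrite (WU w wW); case: (T < _).
Qed.

(** * Distinct representatives and links *)

(** A greedy choice suffices: the |A| - 1 earlier representatives cannot exhaust a set of size |A|.
    The point [x0] is the default value of [v] outside [A]. *)
Lemma distinct_representatives (x0 : V) A (P : J -> {set V}) :
    {in A, forall i, #|A| <= #|P i|} ->
  exists v : J -> V, {in A, forall i, v i \in P i} /\ {in A &, injective v}.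
Proof.
have [m cA] := ubnP #|A|; elim: m => // m IHm in A cA *.
move=> large; have [->|[i iA]] := set_0Vmem A.
  by exists (fun=> x0); split=> i; rewrite inE.
have cAi : #|A| = #|A :\ i|.+1 by rewrite (cardsD1 i A) iA.
have [||v [vP vinj]] := IHm (A :\ i); first by rewrite -cAi.
  by move=> j; rewrite inE => /andP[_ /large]; rewrite cAi => /ltnW.
have /set0Pn[y] : P i :\: v @: (A :\ i) != set0.
  rewrite setD_eq0; apply: contraTN (large i iA) => /subset_leq_card le.
  by rewrite -ltnNge cAi ltnS (leq_trans le) ?leq_imset_card.
rewrite inE => /andP[yv yP].
have yvE j : j \in A -> j != i -> y != v j.
  by move=> jA ji; apply: contraNneq yv => ->; apply: imset_f; rewrite !inE ji.
exists (fun j => if j == i then y else v j); split.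
  by move=> j jA; case: eqVneq => [->//|ji]; apply: vP; rewrite !inE ji.
move=> j l jA lA; case: (eqVneq j i) => [->|ji]; case: (eqVneq l i) => [->//|li].
- by move/eqP; rewrite (negPf (yvE l lA li)).
- by move/esym/eqP; rewrite (negPf (yvE j jA ji)).
- by apply: vinj; rewrite !inE ?ji ?li.
Qed.

(** Discarding edges through v_i that meet another v_j costs at most tB, so more than tB + t of the
    link survive. A rainbow matching of the links lifts by putting each v_i back. *)
Lemma rainbow_links U k A F col :
    0 < k ->
    {in A, forall i, uniform_on U k.+1 (F i)} ->
    {in A, forall i, proper_coloring (F i) (col i)} ->
    {in A, forall i, #|A| <=
      #|[set v in U | 2 * #|A|.-1 * 'C(#|U| - 2, k - 1) + #|A|.-1
                        < deg (F i) v]|} ->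
    (forall U' G col', #|U'| = #|U| - #|A| ->
       {in A, forall i, uniform_on U' k (G i)} ->
       {in A, forall i, {in G i &, injective (col' i)}} ->
       {in A, forall i, #|A|.-1 * ('C(#|U| - 2, k - 1) + 1) < #|G i|} ->
       exists e, rainbow_on A G col' e) ->
  exists e, rainbow_on A F col e.
Proof.
move=> k0 unif prop large IH.
have [A0|[i0 i0A]] := set_0Vmem A.
  by exists (fun=> set0); rewrite A0; split=> i; rewrite inE.
have /card_gt0P[x0 _] : 0 < #|[set v in U | 2 * #|A|.-1 * 'C(#|U| - 2, k - 1)
    + #|A|.-1 < deg (F i0) v]|.
  by apply: leq_trans (large i0 i0A); apply/card_gt0P; exists i0.
have [v [vP vinj]] := distinct_representatives x0 large.
have vU i : i \in A -> v i \in U by move/vP; rewrite inE => /andP[].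
have vdeg i : i \in A ->
    2 * #|A|.-1 * 'C(#|U| - 2, k - 1) + #|A|.-1 < deg (F i) (v i).
  by move/vP; rewrite inE => /andP[].
pose X := v @: A; pose U' := U :\: X.
pose G i := [set g : {set V} | (g \subset U') && ((v i |: g) \in F i)].
pose col' i g := col i (v i |: g).
have XU : X \subset U by apply/subsetP => _ /imsetP[i iA ->]; apply: vU.
have cX : #|X| = #|A| by rewrite card_in_imset.
have vX i : i \in A -> v i \in X by apply: imset_f.
have vg i j g : i \in A -> g \in G j -> v i \notin g.
  move=> iA; rewrite inE => /andP[/subsetP sg _]; apply/negP => /sg.
  by rewrite inE vX.
have [||||g [gG gdisj gcol]] := IH U' G col'.
- by rewrite cardsD (setIidPr XU) cX.
- move=> i iA f fG; have := vg i i f iA fG.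
  move: fG; rewrite inE => /andP[fU' /(unif i iA)[_ cf]] vf.
  by split=> //; move: cf; rewrite cardsU1 vf => -[].
- move=> i iA f f' fG f'G /(proper_inj_star (prop i iA)) eqff'.
  have /setU1K <- := vg i i f iA fG; have /setU1K <- := vg i i f' iA f'G.
  move: fG f'G; rewrite !inE => /andP[_ fF] /andP[_ f'F].
  by rewrite (eqff' (v i)) // !inE ?fF ?f'F eqxx.
- move=> i iA; rewrite -(ltn_add2r (#|A|.-1 * 'C(#|U| - 2, k - 1))).
  suff : deg (F i) (v i) <= #|G i| + #|A|.-1 * 'C(#|U| - 2, k - 1).
    apply: leq_trans; apply: leq_trans (vdeg i iA); lia.
  pose E := [set f in F i | v i \in f].
  pose D := [set f : {set V} | [disjoint X :\ v i & f]].
  rewrite {1}/deg -/E.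
  have cXi : #|X :\ v i| = #|A|.-1 by rewrite -cX (cardsD1 (v i) X) vX.
  (* The sum of codegrees counts every discarded edge at least once; the edges in [D] inject into
     the link. *)
  apply: (@leq_trans (#|G i| + \sum_(x in X :\ v i) deg E x)); last first.
    rewrite leq_add2l -cXi -sum_nat_const; apply: leq_sum => x.
    by rewrite !inE => /andP[xv _]; have := codeg_le (unif i iA) xv; rewrite subSS.
  have -> : \sum_(x in X :\ v i) deg E x
      = \sum_(f in E) #|(X :\ v i) :&: f|.
    under eq_bigr do rewrite degE.
    rewrite exchange_big /=; apply: eq_bigr => f _.
    rewrite -sum1_card big_mkcond [RHS]big_mkcond; apply: eq_bigr => x _ /=.
    by rewrite !inE; case: (_ && _); case: (x \in f).
  rewrite -(cardsID D E) leq_add //.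
    have inj : {in E :&: D &,
                 injective (fun f => f :\ v i)}.
      move=> f f'; rewrite !inE => /andP[/andP[_ vf] _] /andP[/andP[_ vf'] _] eqf.
      by rewrite -(setD1K vf) -(setD1K vf') eqf.
    rewrite -(card_in_imset inj); apply/subset_leq_card/subsetP => _ /imsetP[f fE ->].
    move: fE; rewrite !inE => /andP[/andP[fF vf] fX]; rewrite setD1K // fF andbT.
    have [fU _] := unif i iA f fF.
    apply/subsetP => x; rewrite !inE => /andP[xv xf].
    rewrite (subsetP fU) // andbT; apply/negP => xX.
    by have := disjointFl fX xf; rewrite !inE xv xX.
  rewrite [leqRHS](big_setID D) /=; apply: leq_trans (leq_addl _ _).
  rewrite -sum1_card; apply: leq_sum => f; rewrite !inE => /andP[nd _].
  by rewrite card_gt0 setI_eq0.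
exists (fun i => v i |: g i); split.
- by move=> i /gG; rewrite inE => /andP[].
- move=> i j iA jA ij; rewrite disjoints_subset; apply/subsetP => x.
  rewrite !inE negb_or => /predU1P[->|xg].
    rewrite (vg i j _ iA (gG j jA)) andbT.
    by apply: contra_neq ij; apply: vinj.
  rewrite (disjointFr (gdisj i j iA jA ij) xg) andbT.
  by apply: contraTneq xg => ->; apply: vg (gG i iA).
- by move=> i j iA jA ij; apply: gcol.
Qed.

(** * The trichotomy and dense injectively coloured families *)

(** The induction hypotheses on links and deletions are premises, so one argument serves both
    injective and proper colourings; these differ in the bound [q] on a colour class. *)
Lemma rainbow_step U k A F col q :
    0 < k ->
    {in A, forall i, uniform_on U k.+1 (F i)} ->
    {in A, forall i, proper_coloring (F i) (col i)} ->
    {in A, forall i x, #|[set f in F i | col i f == x]| <= q} ->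
    (forall U' G col', #|U'| = #|U| - #|A| ->
       {in A, forall i, uniform_on U' k (G i)} ->
       {in A, forall i, {in G i &, injective (col' i)}} ->
       {in A, forall i, #|A|.-1 * ('C(#|U| - 2, k - 1) + 1) < #|G i|} ->
       exists e, rainbow_on A G col' e) ->
    {in A & U, forall i v, exists e, rainbow_on (A :\ i) (del_vertex F v) col e} ->
    {in A, forall i, #|A|.-1 *
      ((3 * k + 1) * #|A|.-1 * 'C(#|U| - 2, k - 1) + k.+1 * #|A|.-1 + q) < #|F i|} ->
  exists e, rainbow_on A F col e.
Proof.
move=> k0 unif prop cq IHlink IHdel big.
set t := #|A|.-1 in IHlink big *; set B := 'C(#|U| - 2, k - 1) in IHlink big *.
have [/exists_inP[i iA /exists_inP[v vU high]]|low] :=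
  boolP [exists i in A, exists v in U, k.+1 * t * B + t < deg (F i) v].
  have [e he] := IHdel i v iA vU.
  by apply: (rainbow_extend_high iA unif (prop i iA) he); rewrite subSS.
have {}low i v : i \in A -> v \in U -> deg (F i) v <= k.+1 * t * B + t.
  move=> iA vU; rewrite leqNgt; apply: contraNN low => lt.
  by apply/exists_inP; exists i => //; apply/exists_inP; exists v.
have [/exists_inP[i iA few]|many] := boolP [exists i in A,
    #|[set v in U | 2 * t * B + t < deg (F i) v]| <= t].
  (* Only a matching of the other hypergraphs is wanted here; any vertex of [U] may be deleted to
     obtain it. *)
  have /card_gt0P[f fF] : 0 < #|F i| by apply: leq_ltn_trans (big i iA).
  have [fU cf] := unif i iA f fF.
  have /card_gt0P[v vf] : 0 < #|f| by rewrite cf.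
  have [e he] := IHdel i v iA (subsetP fU v vf).
  have {}he : rainbow_on (A :\ i) F col e.
    by apply: rainbow_onS he => j _; apply: del_vertexS.
  (* The excess [d] is the gap between the degree bounds (k + 1)tB + t and 2tB + t. *)
  apply: (rainbow_extend_few (d := (k - 1) * t * B) iA unif he (cq i iA) _ few).
    move=> w wU; apply: leq_trans (low i w iA wU) _; rewrite -/t; nia.
  apply: leq_ltn_trans (big i iA); rewrite -/t leq_mul2l; apply/orP; right; nia.
apply: (rainbow_links k0 unif prop) => // i iA; rewrite -/t -/B.
have -> : #|A| = t.+1 by rewrite /t (cardsD1 i A) iA.
rewrite ltnNge; apply: contraNN many => le.
by apply/exists_inP; exists i.
Qed.

(* For injective colourings a previous colour kills only one edge, which lets
   the links of a proper colouring be treated by induction on the uniformity. *)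
Lemma rainbow_dense k U A F col :
    {in A, forall i, uniform_on U k.+1 (F i)} ->
    {in A, forall i, {in F i &, injective (col i)}} ->
    3 * k.+1 ^ 2 * #|A| <= #|U| ->
    {in A, forall i, #|A|.-1 * ('C(#|U| - 1, k) + 1) < #|F i|} ->
  exists e, rainbow_on A F col e.
Proof.
elim: k U A F col => [|k IHk] U A F col.
  (* In uniformity one, the t chosen edges block at most t edges by their vertices and t by their
     colours, against more than 2t available. *)
  have [m cA] := ubnP #|A|; elim: m => // m IHm in A cA *.
  move=> unif inj large dense; have [->|[i iA]] := set_0Vmem A.
    by exists (fun=> set0); split=> i; rewrite inE.
  have sAi : {subset A :\ i <= A} by move=> j; rewrite inE => /andP[].
  have cAi : #|A| = #|A :\ i|.+1 by rewrite (cardsD1 i A) iA.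
  have [|||||e he] := IHm (A :\ i).
  - by rewrite -ltnS -cAi.
  - by move=> j /sAi; apply: unif.
  - by move=> j /sAi; apply: inj.
  - by apply: leq_trans large; rewrite leq_mul2l cAi leqnSn orbT.
  - move=> j /sAi/dense; rewrite !bin0; apply: leq_trans.
    by rewrite ltnS leq_mul2r cAi leq_pred orbT.
  apply: (rainbow_extend (q := 1) iA (subxx _) he).
    by move=> x; apply/card_color_class_inj/inj.
  apply: leq_ltn_trans (dense i iA); rewrite muln1 bin0 mulnDr muln1 leq_add2r.
  apply: leq_trans (_ : \sum_(w in \bigcup_(j in A :\ i) e j) 1 <= _).
    apply: leq_sum => w _; apply: leq_trans (deg_le w (unif i iA)) _.
    by rewrite bin0.
  have := card_rainbow_union (fun j jA => unif j (sAi j jA)) he.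
  by rewrite sum1_card mul1n cAi.
have [m cA] := ubnP #|A|; elim: m => // m IHm in A F cA *.
move=> unif inj large dense.
apply: (@rainbow_step U k.+1 A F col 1) => //.
- by move=> i iA; apply/inj_proper/inj.
- by move=> i iA x; apply/card_color_class_inj/inj.
- move=> U' G col' cU' unifG injG denseG; apply: IHk unifG injG _ _.
    by rewrite cU'; nia.
  move=> i iA; apply: leq_ltn_trans (denseG i iA).
  have A0 : 0 < #|A| by apply/card_gt0P; exists i.
  by rewrite leq_mul2l leq_add2r subSS subn0 cU' leq_bin2l ?orbT //; lia.
- move=> i v iA vU.
  have cAi : #|A| = #|A :\ i|.+1 by rewrite (cardsD1 i A) iA.
  have sAi : {subset A :\ i <= A} by move=> j; rewrite inE => /andP[].
  apply: IHm; first by rewrite -ltnS -cAi.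
  + by move=> j /sAi jA; apply: uniform_onS (unif j jA); apply: del_vertexS.
  + move=> j /sAi jA f g /(subsetP (del_vertexS _ _ _)) fF.
    by move=> /(subsetP (del_vertexS _ _ _)) gF; apply: (inj j jA).
  + by apply: leq_trans large; rewrite leq_mul2l cAi leqnSn orbT.
  (* The ground set stays [U]. Deleting [v] costs at most C(n - 1, k + 1) edges, and one hypergraph
     fewer lowers the requirement by one more than that. *)
  + move=> j jA; have := dense j (sAi j jA); rewrite (card_del_vertex F v).
    have := deg_le v (unif j (sAi j jA)); rewrite cAi /= subSS subn0.
    have : 0 < #|A :\ i| by apply/card_gt0P; exists j.
    by case: #|A :\ i| => // t _; rewrite mulSn /=; lia.
- move=> i iA; apply: leq_ltn_trans (dense i iA); rewrite leq_mul2l.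
  apply/orP; right; apply: dense_arith => //.
  by rewrite prednK //; apply/card_gt0P; exists i.
Qed.

(** * Counting under the Ore condition and the induction on the number of hypergraphs *)

(* Double count pairs (S, v) with v in an r-subset S of U. *)
Lemma ore_edges U k E D :
    uniform_on U k.+1 E ->
    (forall S, S \subset U -> #|S| = k.+1 -> S \notin E ->
       k.+1 * D <= deg_set E S) ->
  #|U| * 'C(#|U| - 1, k) * D <= k.+1 * #|E| * ('C(#|U| - 1, k) + D).
Proof.
move=> unif ore; set N := 'C(_, k).
pose P := [set S : {set V} | S \subset U & #|S| == k.+1].
have unifP : uniform_on U k.+1 P by move=> f; rewrite inE => /andP[? /eqP].
have cP : #|U| * N = k.+1 * #|P| by rewrite cards_draws /N subn1 mul_bin_diag.
have degsum : \sum_v deg E v = k.+1 * #|E|.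
  under eq_bigr do rewrite degE.
  rewrite exchange_big mulnC -sum_nat_const; apply: eq_bigr => f fE /=.
  rewrite -(proj2 (unif f fE)) -sum1_card [RHS]big_mkcond /=.
  by apply: eq_bigr => v _; case: (v \in f).
have ub : \sum_(S in P) deg_set E S <= k.+1 * #|E| * N.
  rewrite -degsum big_distrl /=.
  apply: leq_trans (_ : \sum_v deg E v * deg P v <= _); last first.
    apply: leq_sum => v _; rewrite leq_mul2l; apply/orP; right.
    by have := deg_le v unifP; rewrite subSS subn0.
  under [leqRHS]eq_bigr do rewrite [deg P _]degE big_distrr /=.
  rewrite [leqRHS]exchange_big /=; apply: leq_sum => S _; rewrite /deg_set big_mkcond /=.
  by apply: leq_sum => v _; case: (v \in S); rewrite ?muln1.
have lb : #|P :\: E| * (k.+1 * D) <= \sum_(S in P) deg_set E S.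
  rewrite -sum_nat_const [leqRHS](big_setID E) /=.
  apply: leq_trans (leq_addl _ _); apply: leq_sum => S.
  by rewrite !inE => /and3P[SE SU /eqP cS]; apply: ore.
have cPE : #|P| <= #|E| + #|P :\: E|.
  by rewrite -(cardsID E P) leq_add2r subset_leq_card // subsetIr.
(* Splitting the r-sets into edges and non-edges, the edges give the term in D and the non-edges the
   term in N. *)
rewrite cP mulnDr.
apply: leq_trans (_ : k.+1 * (#|E| + #|P :\: E|) * D <= _).
  by rewrite leq_mul2r leq_mul2l cPE !orbT.
have := leq_trans lb ub; lia.
Qed.

(** Each vertex of [S] differs from [v], so it loses only its codegree with [v]. *)
Lemma deg_set_del U k F i v S :
    uniform_on U k (F i) -> v \notin S ->
  deg_set (F i) S <= deg_set (del_vertex F v i) S + #|S| * 'C(#|U| - 2, k - 2).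
Proof.
move=> unif vS; rewrite /deg_set -sum_nat_const -big_split /=.
apply: leq_sum => u uS.
have uv : u != v by apply: contraNneq vS => <-.
apply: leq_trans (leq_add (leqnn _) (codeg_le unif uv)).
rewrite addnC {1}/deg -(cardsID [set f : {set V} | v \in f]).
by apply: eq_leq; congr (_ + _); apply: eq_card => f; rewrite !inE;
  case: (f \in F i); case: (u \in f); case: (v \in f).
Qed.

(** Runs [rainbow_step] with [q] the size bound of a proper colour class; the links go to
    [rainbow_dense], and the edge bound comes from [ore_edges] and [ore_arith]. *)
Lemma rainbow_ore k U A F col :
    1 < k ->
    {in A, forall i, uniform_on U k.+1 (F i)} ->
    {in A, forall i, proper_coloring (F i) (col i)} ->
    3 * k.+1 ^ 2 * #|A| < #|U| ->
    {in A, forall i S, S \subset U -> #|S| = k.+1 -> S \notin F i ->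
       k.+1 * ('C(#|U| - 1, k) - 'C(#|U| - #|A|, k)) < deg_set (F i) S} ->
  exists e, rainbow_on A F col e.
Proof.
move=> k1; have [m cA] := ubnP #|A|; elim: m => // m IHm in U A F cA *.
move=> unif prop large ore.
apply: (@rainbow_step U k A F col (#|U| %/ k.+1)) => //.
- exact: ltnW.
- by move=> i iA x; apply: card_color_class_proper; [apply: unif|apply: prop|].
- case: k k1 unif large {IHm ore} => // k k1 unif large.
  move=> U' G col' cU' unifG injG denseG; apply: rainbow_dense unifG injG _ _.
    by rewrite cU'; nia.
  move=> i iA; apply: leq_ltn_trans (denseG i iA).
  have A0 : 0 < #|A| by apply/card_gt0P; exists i.
  by rewrite leq_mul2l leq_add2r subSS subn0 cU' leq_bin2l ?orbT //; lia.
- move=> i v iA vU.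
  have cAi : #|A| = #|A :\ i|.+1 by rewrite (cardsD1 i A) iA.
  have cUv : #|U| = #|U :\ v|.+1 by rewrite (cardsD1 v U) vU.
  have sAi : {subset A :\ i <= A} by move=> j; rewrite inE => /andP[].
  apply: (IHm (U :\ v)); first by rewrite -ltnS -cAi.
  + move=> j /sAi jA f; rewrite inE => /andP[fF vf].
    by have [fU cf] := unif j jA f fF; rewrite subsetD1 fU vf.
  + by move=> j /sAi jA; apply: proper_coloringS (prop j jA); apply: del_vertexS.
  + by move: large; rewrite cAi cUv; nia.
  + move=> j jAi S; have jA := sAi j jAi.
    have Ai0 : 0 < #|A :\ i| by apply/card_gt0P; exists j.
    rewrite subsetD1 => /andP[SU vS] cS SF.
    have {}SF : S \notin F j by move: SF; rewrite inE vS andbT.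
    have := ore j jA S SU cS SF; have := deg_set_del (unif j jA) vS.
    rewrite cS cAi !subSS; set B := 'C(#|U| - 2, k - 1).
    (* By Pascal's rule the threshold drops by exactly the codegree bound B per vertex of [S], while
       n - s is unchanged when both decrease by one. *)
    have -> : 'C(#|U| - 1, k) = 'C(#|U :\ v| - 1, k) + B.
      have -> : #|U| - 1 = (#|U :\ v| - 1).+1 by move: large; rewrite cAi; lia.
      by rewrite -(@prednK k) 1?ltnW // binS /B; congr ('C(_, _) + 'C(_, _)); lia.
    have -> : #|U| - #|A :\ i|.+1 = #|U :\ v| - #|A :\ i| by rewrite cUv.
    set N := 'C(_ - 1, k); set M := 'C(_ - _, k).
    have MN : M <= N by rewrite leq_bin2l // leq_sub2l.
    by rewrite -addnBAC // mulnDr; lia.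
- move=> i iA.
  have A0 : 0 < #|A| by apply/card_gt0P; exists i.
  (* For a single hypergraph the threshold is 0, and its strictness yields an edge: any non-edge has
     positive degree sum. *)
  have [A1|A1] := eqVneq #|A|.-1 0.
    rewrite A1 mul0n; apply/card_gt0P.
    have : 0 < #|[set S : {set V} | S \subset U & #|S| == k.+1]|.
      by rewrite cards_draws bin_gt0; nia.
    case/card_gt0P => S; rewrite inE => /andP[SU /eqP cS].
    case: (boolP (S \in F i)) => [|SF]; first by exists S.
    have /(leq_ltn_trans (leq0n _)) := ore i iA S SU cS SF.
    rewrite lt0n sum_nat_eq0 negb_forall_in => /exists_inP[v _].
    by rewrite -lt0n => /card_gt0P[f]; rewrite inE => /andP[fF _]; exists f.
  apply: ore_arith; rewrite ?lt0n ?prednK ?leq_trunc_div //.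
  apply: ore_edges; first exact: unif.
  by move=> S SU cS SF; apply/ltnW/ore.
Qed.

End RainbowMatchings.

Theorem theorem1p8 (r s n : nat) (V : finType) (C : eqType)
    (H : 'I_s -> {set {set V}}) (col : 'I_s -> {set V} -> C)
    (hr : 3 <= r) (hs : 1 <= s) (hn : 3 * r ^ 2 * s < n)
    (hV : #|V| = n)
    (hunif : forall i, uniform r (H i))
    (hcol : forall i, proper_coloring (H i) (col i))
    (hore : forall i,
      (((r * ('C(n - 1, r - 1) - 'C(n - s, r - 1)))%N%:Z)%:E
         < ore_degree r (H i))%E) :
  exists e : 'I_s -> {set V}, rainbow_matching H col e.
Proof.
case: r hr hn hunif hore => // k hr hn hunif hore.
have [|||||e [eH edisj ecol]] := @rainbow_ore V 'I_s C k setT setT H col.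
- exact: hr.
- by move=> i _ f fH; split; [apply: subsetT|apply: hunif fH].
- by move=> i _; apply: hcol.
- by rewrite !cardsT card_ord hV.
- move=> i _ S _ cS SH; rewrite !cardsT card_ord hV.
  by have /lt_ore_degree/(_ S cS SH) := hore i; rewrite subSS subn0.
by exists e; split=> [i|i j|i j]; [apply: eH|apply: edisj|apply: ecol].
Qed.
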